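(* Let $\mathcal C$ be an admissible class of graphons. If $H$ is a $\mathcal C$-Sidorenko graph that is not a matching, then $H$ is $\mathcal C$-forcing if and only if $H$ is $\mathcal C$-regular-forcing. In particular, taking $\mathcal C$ to be the class of all graphons, every non-matching Sidorenko graph is forcing if and only if it is regular-forcing.
   Context: All underlying probability spaces $(\Omega,\mu)$ are standard and atomless (so isomorphic to $[0,1]$ with Lebesgue measure). A graphon is a symmetric measurable function $W:\Omega^2\to[0,1]$ on such a space. Graphs are finite and simple, with at least one edge; isolated vertices are deleted, so $v(H)$ denotes the number of non-isolated vertices of $H$ and $e(H)$ the number of edges; a matching is a graph $mK_2$ (after deletion of isolated vertices). The homomorphism density is $t(H,W)=\int_{\Omega^{V(H)}}\prod_{uv\in E(H)}W(x_u,x_v)\prod_{u\in V(H)}d\mu(x_u)$, and $p(W)=t(K_2,W)=\int_{\Omega^2}W\,d\mu\,d\mu$. The degree function is $\deg_W(x)=\int_\Omega W(x,y)\,d\mu(y)$; $W$ is regular if $\deg_W=p(W)$ almost everywhere. $\mathbf 1$ denotes the constant function $1$. For $k\ge1$, the tensor power $W^{\otimes k}$ is the graphon on $(\Omega^k,\mu^k)$ given by $W^{\otimes k}(x,y)=\prod_{r=1}^kW(x_r,y_r)$. For measurable $S\subseteq\Omega$ with $\alpha=\mu(S)>0$, the normalized principal restriction $W[S]$ is the graphon on $(S,\mu|_S/\alpha)$ given by $W[S](x,y)=W(x,y)$ for $x,y\in S$. A class $\mathcal C$ of graphons (considered up to measure-preserving isomorphism of the underlying standard atomless probability spaces) is admissible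 if: (A1) $W\in\mathcal C$ implies $W^{\otimes k}\in\mathcal C$ for every $k\ge1$; (A2) $W\in\mathcal C$ and $S$ a positive-measure measurable subset of the underlying space of $W$ imply $W[S]\in\mathcal C$. (The class of all graphons is admissible.) $H$ is $\mathcal C$-Sidorenko if $t(H,W)\ge p(W)^{e(H)}$ for every $W\in\mathcal C$. A $\mathcal C$-Sidorenko graph $H$ is $\mathcal C$-forcing if, whenever $W\in\mathcal C$ satisfies $t(H,W)=p(W)^{e(H)}$, one has $W=p(W)\mathbf 1$ almost everywhere; it is $\mathcal C$-regular-forcing if the same implication is required only for regular graphons $W\in\mathcal C$. When $\mathcal C$ is the class of all graphons these notions are called Sidorenko, forcing, and regular-forcing respectively. *)

(* Defs.v *)
From HB Require Import structures.
From mathcomp Require Import all_boot all_order all_algebra.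
From mathcomp Require Import all_classical all_reals all_analysis.

Set Implicit Arguments.
Unset Strict Implicit.
Unset Printing Implicit Defensive.
Import Order.TTheory GRing.Theory Num.Theory.

Local Open Scope classical_set_scope.
Local Open Scope ring_scope.

Record sgraph := SGraph {
  vertex : finType;
  adj : rel vertex;
  adj_sym : symmetric adj;
  adj_irr : irreflexive adj;
  adj_edge : exists u v, adj u v }.

(* Each edge is listed once, oriented along the enumeration of the vertices. *)
Definition edges (H : sgraph) : {set vertex H * vertex H} :=
  [set p | adj p.1 p.2 && (enum_rank p.1 < enum_rank p.2)%N]%SET.

(* Up to isolated vertices, the graph is a copy of m K_2, whose vertex set is
   'I_m * bool and whose edges join (i, b) to (i, ~~ b). *)
Definition is_matching (H : sgraph) : Prop :=
  exists (m : nat) (f : 'I_m * bool -> vertex H), injective f /\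
    forall u v, adj u v <-> exists i b, u = f (i, b) /\ v = f (i, ~~ b).

Section product_power.
Context d (T : measurableType d) (R : realType).

Definition tuple_cons n (p : T * n.-tuple T) : n.+1.-tuple T :=
  [the n.+1.-tuple T of p.1 :: p.2].

Lemma measurable_tuple_cons n : measurable_fun setT (@tuple_cons n).
Proof. exact: measurable_cons. Qed.

HB.instance Definition _ n :=
  isMeasurableFun.Build _ _ _ _ (@tuple_cons n) (@measurable_tuple_cons n).

Fixpoint power_prob (mu : probability T R) n : probability (n.-tuple T) R :=
  if n is n'.+1 then
    distribution (mu \x power_prob mu n')%E (@tuple_cons n')
  else \d_[tuple].

Lemma power_prob_box (mu : probability T R) n (A : 'I_n -> set T) :
  (forall i, measurable (A i)) ->
  power_prob mu n [set x | forall i, A i (tnth x i)] =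
  (\prod_(i < n) mu (A i))%E.
Proof.
elim: n A => [|n IH] A mA.
  rewrite big_ord0 /= diracE mem_set//= => -[].
  by [].
rewrite big_ord_recl /= /distribution /pushforward.
set B := [set x | forall i, A (lift ord0 i) (tnth x i)].
rewrite (_ : _ @^-1` _ = A ord0 `*` B).
  rewrite product_measure1E//; first by congr (_ * _)%E; exact: IH.
  rewrite (_ : B = \bigcap_(i in [set: 'I_n])
      ((fun x : n.-tuple T => tnth x i) @^-1` A (lift ord0 i))).
    apply: fin_bigcap_measurable => // i _.
    by rewrite -[X in measurable X]setTI; exact: measurable_tnth.
  by apply/seteqP; split => x /= h i; [move=> _; exact: h|exact: h].
apply/seteqP; split => -[x t] /=.
  move=> h; split; first exact: (h ord0).
  by move=> i; have := h (lift ord0 i); rewrite /tuple_cons tnthS.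
move=> [/= Ax Bt] i; case: (unliftP ord0 i) => [j|] ->.
  by rewrite /tuple_cons tnthS; exact: Bt.
exact: Ax.
Qed.

End product_power.

(* A measurable space is Borel isomorphic to a Borel subset of the line
   exactly when it is the Borel space of a Polish space. *)
Definition standard_borel (R : realType) d (T : measurableType d) : Prop :=
  exists f : T -> R, [/\ injective f, measurable_fun setT f &
    forall A : set T, measurable A -> measurable (f @` A)].

Definition atomless (R : realType) d (T : measurableType d)
    (mu : probability T R) : Prop :=
  forall A : set T, measurable A -> (0 < mu A)%E ->
  exists B : set T, [/\ measurable B, B `<=` A, (0 < mu B)%E & (mu B < mu A)%E].

(* A symmetric measurable [0,1]-valued function on the square of an arbitrary
   probability space; it is a graphon when the space is standard and
   atomless. *)
Record pregraphon (R : realType) := PreGraphon {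
  gdisp : measure_display;
  gspace : measurableType gdisp;
  gmu : probability gspace R;
  gfun :> gspace * gspace -> R;
  gfun_measurable : measurable_fun setT gfun;
  gfun_sym : forall x y, gfun (x, y) = gfun (y, x);
  gfun_itv : forall z, 0 <= gfun z <= 1 }.

Definition graphon (R : realType) (W : pregraphon R) : Prop :=
  standard_borel R (gspace W) /\ atomless (gmu W).

Section densities.
Context (R : realType).
Implicit Types (W : pregraphon R) (H : sgraph).

(* The coordinate of the vertex u is the one of index enum_rank u; an isolated
   vertex only contributes the factor mu(Omega) = 1. *)
Definition hom_density H W : R :=
  \int[power_prob (gmu W) #|vertex H|]_x
    \prod_(p in edges H)
       W (tnth x (enum_rank p.1), tnth x (enum_rank p.2)).

Definition edge_density W : R := \int[(gmu W \x gmu W)%E]_z W z.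

Definition degree W (x : gspace W) : R := \int[gmu W]_y W (x, y).

Definition regular W : Prop :=
  {ae gmu W, forall x, degree x = edge_density W}.

Definition ae_constant W : Prop :=
  {ae (gmu W \x gmu W)%E, forall z, W z = edge_density W}.

End densities.

Section tensor_power.
Context (R : realType) (W : pregraphon R) (k : nat).

Let T := k.-tuple (gspace W).

Definition tensor_fun (z : T * T) : R :=
  \prod_(r < k) W (tnth z.1 r, tnth z.2 r).

Lemma tensor_fun_measurable : measurable_fun setT tensor_fun.
Proof.
apply: measurable_prod => r _.
apply: measurableT_comp; first exact: gfun_measurable.
by apply: measurable_fun_pair;
  apply: (measurableT_comp (measurable_tnth r)).
Qed.

Lemma tensor_fun_sym x y : tensor_fun (x, y) = tensor_fun (y, x).
Proof. by apply: eq_bigr => r _; exact: gfun_sym. Qed.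

Lemma tensor_fun_itv z : 0 <= tensor_fun z <= 1.
Proof.
apply/andP; split.
  by apply: prodr_ge0 => r _; case/andP: (gfun_itv (tnth z.1 r, tnth z.2 r)).
by apply: prodr_ile1 => r _; exact: gfun_itv.
Qed.

Definition tensor_power : pregraphon R :=
  PreGraphon (power_prob (gmu W) k)
    tensor_fun_measurable tensor_fun_sym tensor_fun_itv.

End tensor_power.

(* The nonemptiness proof makes the subtype pointed, as required of a
   measurableType. *)
Definition subset_type T (S : set T) of S !=set0 := {x : T | x \in S}.

Section subset_measurable.
Context d (T : measurableType d) (S : set T) (S0 : S !=set0).

Let subset_point : subset_type S0 := let: exist x Sx := cid S0 in
  exist (fun x => x \in S) x (mem_set Sx).

HB.instance Definition _ := gen_eqMixin (subset_type S0).
HB.instance Definition _ := gen_choiceMixin (subset_type S0).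
HB.instance Definition _ := isPointed.Build (subset_type S0) subset_point.

Definition subset_val (x : subset_type S0) : T := sval x.

Definition subset_space := g_sigma_algebra_preimageType subset_val.

Lemma subset_val_image A : measurable S ->
  @measurable _ subset_space A -> measurable (subset_val @` A).
Proof.
move=> mS [B mB <-]; rewrite setTI.
rewrite (_ : _ @` _ = B `&` S); first exact: measurableI.
apply/seteqP; split=> [_ [[x Sx] /= Bx <-]|x [Bx Sx]].
  by split => //; exact: set_mem.
by exists (exist (fun x => x \in S) x (mem_set Sx)).
Qed.

Lemma subset_val_measurable :
  measurable_fun [set: subset_space] (subset_val : subset_space -> T).
Proof. by move=> _ B mB; exists B. Qed.

End subset_measurable.
Arguments subset_val {d T S} S0 x.
Arguments subset_val_measurable {d T S} S0.

Section restriction.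
Context d (T : measurableType d) (R : realType) (mu : probability T R).
Context (S : set T) (mS : measurable S) (S_gt0 : (0 < mu S)%E).

Lemma pos_measure_neq0 : S !=set0.
Proof.
by apply/set0P/eqP => S0; move: S_gt0; rewrite S0 measure0 ltxx.
Qed.

Let T' := subset_space pos_measure_neq0.
Let val : T' -> T := subset_val pos_measure_neq0.

Definition restr_prob (A : set T') : \bar R :=
  (mrestr mu mS (val @` A) * ((fine (mu S))^-1)%:E)%E.

Let val_inj : injective val.
Proof. by move=> [x Sx] [y Sy] /= xy; exact: eq_exist. Qed.

Let restr_prob0 : restr_prob set0 = 0%E.
Proof. by rewrite /restr_prob image_set0 measure0 mul0e. Qed.

Let restr_prob_ge0 A : (0 <= restr_prob A)%E.
Proof. by rewrite mule_ge0// lee_fin invr_ge0 fine_ge0. Qed.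

Let restr_prob_sigma_additive : semi_sigma_additive restr_prob.
Proof.
move=> F mF tF mUF; rewrite /restr_prob image_bigcup.
rewrite [X in X @ _ --> _](_ : _ = (fun n =>
  (\sum_(0 <= i < n) mrestr mu mS (val @` F i)) * ((fine (mu S))^-1)%:E)%E); last first.
  by apply/funext => n; rewrite ge0_sume_distrl.
have mvF i : measurable (val @` F i) by exact: subset_val_image.
apply: cvgeZr => //; apply: measure_sigma_additive => //.
apply/trivIsetP => i j _ _ ij; rewrite -subset0 => _ [[x Fx <-] [y Fy]].
move=> /val_inj yx; move/trivIsetP : tF => /(_ i j I I ij).
by rewrite -subset0 => /(_ x); apply; split => //; rewrite -yx.
Qed.

HB.instance Definition _ := isMeasure.Build _ _ _ restr_prob
  restr_prob0 restr_prob_ge0 restr_prob_sigma_additive.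

Let restr_prob_setT : restr_prob setT = 1%E.
Proof.
rewrite /restr_prob /mrestr (_ : val @` setT = S); last first.
  apply/seteqP; split=> [_ [[x Sx] _ <-]|x Sx]; first exact: set_mem.
  by exists (exist (fun x => x \in S) x (mem_set Sx)).
rewrite setIid; have fS : mu S \is a fin_num by exact: fin_num_measure.
rewrite -[X in (X * _)%E]fineK// -EFinM divff// gt_eqF// fine_gt0//.
by rewrite S_gt0/= ltey_eq fS.
Qed.

HB.instance Definition _ :=
  Measure_isProbability.Build _ _ _ restr_prob restr_prob_setT.

End restriction.
Arguments restr_prob {d T R} mu {S} mS S_gt0 A.

Section graphon_restriction.
Context (R : realType) (W : pregraphon R) (S : set (gspace W)).
Context (mS : measurable S) (S_gt0 : (0 < gmu W S)%E).

Let S0 := pos_measure_neq0 S_gt0.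
Let T' := subset_space S0.

Definition restriction_fun (z : T' * T') : R :=
  W (subset_val S0 z.1, subset_val S0 z.2).

Lemma restriction_fun_measurable : measurable_fun setT restriction_fun.
Proof.
apply: measurableT_comp; first exact: gfun_measurable.
by apply: measurable_fun_pair;
  apply: (measurableT_comp (subset_val_measurable S0)).
Qed.

Lemma restriction_fun_sym x y : restriction_fun (x, y) = restriction_fun (y, x).
Proof. exact: gfun_sym. Qed.

Lemma restriction_fun_itv z : 0 <= restriction_fun z <= 1.
Proof. exact: gfun_itv. Qed.

Definition restriction : pregraphon R :=
  PreGraphon (restr_prob (gmu W) mS S_gt0)
    restriction_fun_measurable restriction_fun_sym restriction_fun_itv.

End graphon_restriction.

Section classes.
Context (R : realType).
Implicit Types (C : pregraphon R -> Prop) (W : pregraphon R) (H : sgraph).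

(* Pointwise isomorphism: a class closed under isomorphism modulo null sets is
   in particular closed under this relation. *)
Definition graphon_iso W1 W2 : Prop :=
  exists (f : gspace W1 -> gspace W2) (g : gspace W2 -> gspace W1),
    [/\ cancel f g /\ cancel g f,
        measurable_fun setT f /\ measurable_fun setT g,
        forall A, measurable A -> gmu W1 (f @^-1` A) = gmu W2 A &
        forall x y, W1 (x, y) = W2 (f x, f y)].

Record admissible C : Prop := Admissible {
  admissible_graphon : forall W, C W -> graphon W;
  admissible_iso : forall W1 W2, graphon W2 -> graphon_iso W1 W2 ->
    C W1 -> C W2;
  admissible_tensor : forall W k, (0 < k)%N -> C W -> C (tensor_power W k);
  admissible_restriction : forall W (S : set (gspace W))
    (mS : measurable S) (S_gt0 : (0 < gmu W S)%E),
    C W -> C (restriction mS S_gt0) }.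

Definition sidorenko C H : Prop :=
  forall W, C W -> edge_density W ^+ #|edges H| <= hom_density H W.

Definition forcing C H : Prop :=
  sidorenko C H /\
  forall W, C W -> hom_density H W = edge_density W ^+ #|edges H| ->
    ae_constant W.

Definition regular_forcing C H : Prop :=
  sidorenko C H /\
  forall W, C W -> regular W ->
    hom_density H W = edge_density W ^+ #|edges H| -> ae_constant W.

End classes.

(* Main.v *)
From HB Require Import structures.
Require Import Defs.
From mathcomp Require Import all_boot all_order all_algebra.
From mathcomp Require Import all_classical all_reals all_analysis.
From mathcomp Require Import measurable_realfun lra.

Set Implicit Arguments.
Unset Strict Implicit.
Unset Printing Implicit Defensive.
Import Order.TTheory GRing.Theory Num.Theory.
Import numFieldNormedType.Exports.

Local Open Scope classical_set_scope.
Local Open Scope ring_scope.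

(** The point is that a Sidorenko graph H that is not a matching can only
attain equality on a regular graphon; the two forcing notions then ask for the
same thing.

Write p for the edge density of W, v for the number of non-isolated vertices of
H and e for its number of edges; since H is not a matching, v < 2e
([nonisolated_lt_edges]). Let S be the set of the vertices of degree at least p
and alpha its measure. Restricting to S multiplies the density of H by at most
alpha^(-v) ([hom_density_restriction]), whereas the edge density becomes
alpha^(-2) times the mass of W on S x S. If S is small but still carries almost
all the mass of W, then 2e > v makes the restriction W[S] violate the Sidorenko
inequality as soon as t(H, W) = p^e.

Such an S appears in a tensor power of W when W is not regular. The probability
measures mu and (deg / p) mu are then distinct, hence their k-th powers are
asymptotically singular, and S, applied to the k-th power of W, separates them.
The quantity that measures this is the Hellinger affinity Q, the integral of
sqrt (p deg): alpha p and the mass of the degree outside S are both at most Q,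
which gives [affinity_bound]; Q is multiplicative under tensor powers
([affinity_tensor]); and Q < p unless W is regular ([regular_of_affinity]).
So Q / p tends to 0 exponentially along the tensor powers, while p and t(H, W)
are multiplicative as well ([hom_density_tensor]), and the bound fails for a
large power ([sidorenko_equality_regular]).

For the class of all graphons it remains to see that tensor powers and
restrictions of graphons are graphons ([admissible_all_graphons]). Products of
standard Borel spaces are standard Borel because the plane embeds in the line:
a pair of reals is coded by the bits telling which rationals lie below each
coordinate, and these bits are read as the digits, 0 or 2, of a ternary
expansion; a measurable left inverse makes the images of Borel sets Borel. *)

(** * Integration over finite powers of a probability space *)

Lemma integral_prob_cst d (T : measurableType d) (R : realType)
    (P : probability T R) (c : \bar R) : (\int[P]_x cst c x = c)%E.
Proof. by rewrite integral_cst// [X in (_ * X)%E](probability_setT P) mule1. Qed.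

Section power_integral.
Local Open Scope ereal_scope.
Context d (T : measurableType d) (R : realType) (mu : probability T R).

Lemma integral_power0 (f : 0.-tuple T -> \bar R) : measurable_fun setT f ->
  \int[power_prob mu 0]_x f x = f [tuple].
Proof. by move=> mf; rewrite /= integral_dirac// diracT mul1e. Qed.

Lemma integral_powerS n (f : n.+1.-tuple T -> \bar R) :
  measurable_fun setT f -> (forall x, 0 <= f x) ->
  \int[power_prob mu n.+1]_x f x =
  \int[mu]_x \int[power_prob mu n]_t f (tuple_cons (x, t)).
Proof.
move=> mf f0.
rewrite [LHS](ge0_integral_distribution (@tuple_cons _ T n : {mfun _ >-> _}))//.
rewrite fubini_tonelli1//.
- exact: measurableT_comp.
- by move=> x; exact: f0.
Qed.

(** Independence of the coordinates; this makes the degree, the edge density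
and the affinity multiplicative under tensor powers. *)
Lemma integral_power_prod n (g : 'I_n -> T -> R) (r : 'I_n -> R) :
  (forall i, measurable_fun setT (g i)) -> (forall i x, 0 <= g i x)%R ->
  (forall i, \int[mu]_x (g i x)%:E = (r i)%:E) ->
  \int[power_prob mu n]_x (\prod_(i < n) g i (tnth x i))%:E =
  (\prod_(i < n) r i)%:E.
Proof.
elim: n g r => [|n IH] g r mg g0 gr.
  by rewrite integral_power0 ?big_ord0//; apply/measurable_EFinP;
    apply: measurable_prod => -[].
have mP k (h : 'I_k -> T -> R) : (forall i, measurable_fun setT (h i)) ->
    measurable_fun setT (fun x : k.-tuple T => (\prod_(i < k) h i (tnth x i))%:E).
  move=> mh; apply/measurable_EFinP; apply: measurable_prod => i _.
  by apply: measurableT_comp => //; exact: measurable_tnth.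
rewrite integral_powerS; last 2 first.
- exact: mP.
- by move=> x; rewrite lee_fin prodr_ge0.
pose r' := (\prod_(i < n) r (lift ord0 i))%R.
have gr' := IH (fun i => g (lift ord0 i)) (fun i => r (lift ord0 i))
  (fun i => mg _) (fun i => g0 _) (fun i => gr _).
transitivity (\int[mu]_x (r'%:E * (g ord0 x)%:E)).
  apply: eq_integral => x _.
  rewrite -gr' muleC -ge0_integralZl ?lee_fin//; last 2 first.
  - by apply: (mP _ (fun i => g (lift ord0 i))) => i; exact: mg.
  - by move=> t _; rewrite lee_fin prodr_ge0.
  apply: eq_integral => t _.
  rewrite big_ord_recl EFinM /=; congr (_ * (_)%:E).
  by apply: eq_bigr => i _; rewrite /tuple_cons tnthS.
have r0 i : (0 <= r i)%R.
  by rewrite -lee_fin -gr; apply: integral_ge0 => x _; rewrite lee_fin.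
rewrite ge0_integralZl ?lee_fin ?prodr_ge0//; last 2 first.
- exact/measurable_EFinP.
- by move=> x _; rewrite lee_fin.
by rewrite gr -EFinM mulrC big_ord_recl.
Qed.

End power_integral.

Lemma measurable_map_tuple d1 d2 (Z : measurableType d1) (T : measurableType d2)
    (a : Z -> T) n :
  measurable_fun setT a ->
  measurable_fun setT (fun z : n.-tuple Z => [tuple of map a z]).
Proof.
move=> ma; apply/measurable_fun_tnthP => i.
rewrite (_ : _ \o _ = a \o (fun z => tnth z i)); last first.
  by apply/funext => z /=; rewrite tnth_map.
by apply: measurableT_comp => //; exact: measurable_tnth.
Qed.

Definition depends_only_on (T S : Type) n (A : {set 'I_n})
    (F : n.-tuple T -> S) :=
  forall x y, (forall i, i \in A -> tnth x i = tnth y i) -> F x = F y.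

Section couplings.
Local Open Scope ereal_scope.
Context d0 d1 d2 (Z : measurableType d0) (T : measurableType d1)
  (U : measurableType d2) (R : realType) (la : probability Z R)
  (mu : probability T R) (nu : probability U R).
Context (a : Z -> T) (b : Z -> U).
Hypotheses (ma : measurable_fun setT a) (mb : measurable_fun setT b).

Lemma map_tuple_cons n (z : Z) (t : n.-tuple Z) :
  [tuple of map a (tuple_cons (z, t))] = tuple_cons (a z, [tuple of map a t]).
Proof. exact/val_inj. Qed.

(** A domination of measures costs one factor c per coordinate on which the
integrand depends, and nothing for the others because the measures are
probabilities. The exponent v, rather than the number of all vertices, in the
comparison with 2e comes from here. *)
Lemma integral_power_dominated (c : R) n (A : {set 'I_n})
    (F : n.-tuple T -> \bar R) : (0 <= c)%R ->
  (forall f : T -> \bar R, measurable_fun setT f -> (forall x, 0 <= f x) ->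
    \int[la]_z f (a z) <= c%:E * \int[mu]_x f x) ->
  measurable_fun setT F -> (forall x, 0 <= F x) -> depends_only_on A F ->
  \int[power_prob la n]_z F [tuple of map a z] <=
  (c ^+ #|A|)%:E * \int[power_prob mu n]_x F x.
Proof.
move=> c0 lamu; elim: n A F => [|n IH] A F mF F0 FA.
  have -> : #|A| = 0%N.
    by apply: eq_card0 => -[].
  rewrite expr0 mul1e !integral_power0//; last first.
    by apply: measurableT_comp => //; exact: measurable_map_tuple.
  by rewrite le_eqVlt; apply/orP; left; apply/eqP; congr F; exact/val_inj.
pose A' := [set i | lift ord0 i \in A]%SET.
have mFx x : measurable_fun setT (fun t => F (tuple_cons (x, t))).
  apply: measurableT_comp => //.
  apply: measurableT_comp; last exact: pair1_measurable.
  exact: measurable_tuple_cons.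
have mI : measurable_fun setT
    (fun x => \int[power_prob mu n]_t F (tuple_cons (x, t))).
  apply: (measurable_fun_fubini_tonelli_F (fun p => F (tuple_cons p))) => //.
  by apply: measurableT_comp => //; exact: measurable_tuple_cons.
have I0 x : 0 <= \int[power_prob mu n]_t F (tuple_cons (x, t)).
  exact: integral_ge0.
rewrite !integral_powerS//; last first.
  by apply: measurableT_comp => //; exact: measurable_map_tuple.
have step : \int[la]_z \int[power_prob la n]_t
      F [tuple of map a (tuple_cons (z, t))] <=
    (c ^+ #|A'|)%:E *
    \int[la]_z \int[power_prob mu n]_t F (tuple_cons (a z, t)).
  rewrite -ge0_integralZl//; last 2 first.
  - exact: (measurableT_comp mI ma).
  - by rewrite lee_fin exprn_ge0.
  apply: ge0_le_integral => //.
  - by move=> z _; exact: integral_ge0.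
  - apply: (measurable_fun_fubini_tonelli_F
      (fun p => F [tuple of map a (tuple_cons p)])) => //.
    apply: measurableT_comp => //.
    apply: (measurableT_comp (measurable_map_tuple ma)).
    exact: measurable_tuple_cons.
  - by apply: measurable_funeM; exact: (measurableT_comp mI ma).
  - move=> z _.
    under eq_integral do rewrite map_tuple_cons.
    apply: (IH A' (fun t => F (tuple_cons (a z, t)))) => // x y xy.
    apply: FA => i; case: (unliftP ord0 i) => [j|] -> iA.
      by rewrite /tuple_cons !tnthS; apply: xy; rewrite inE.
    by rewrite !tnth0.
apply: (le_trans step).
have [A0|A0] := boolP (ord0 \in A).
  have -> : #|A| = #|A'|.+1.
    rewrite (cardD1 ord0) A0 add1n; congr S.
    rewrite -[RHS](card_imset _ (@lift_inj _ ord0)); apply: eq_card => i.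
    rewrite !inE; case: (unliftP ord0 i) => [j|] ->.
      by rewrite eq_sym neq_lift mem_imset ?inE//; exact: lift_inj.
    rewrite eqxx /=; apply/esym/negbTE/imsetP => -[j _ /eqP].
    by rewrite -(negbK (_ == _)) neq_lift.
  by rewrite exprSr EFinM -muleA lee_wpmul2l ?lee_fin ?exprn_ge0// lamu.
have -> : #|A| = #|A'|.
  rewrite -[RHS](card_imset _ (@lift_inj _ ord0)); apply: eq_card => i.
  case: (unliftP ord0 i) => [j|] ->.
    by rewrite mem_imset ?inE//; exact: lift_inj.
  rewrite (negbTE A0); apply/esym/negbTE/imsetP => -[j _ /eqP].
  by rewrite -(negbK (_ == _)) neq_lift.
have Fc x y : \int[power_prob mu n]_t F (tuple_cons (x, t)) =
    \int[power_prob mu n]_t F (tuple_cons (y, t)).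
  apply: eq_integral => t _; apply: FA => i.
  case: (unliftP ord0 i) => [j|] -> iA; first by rewrite /tuple_cons !tnthS.
  by rewrite iA in A0.
have Ic d' (V : measurableType d') (P : probability V R) (h : V -> T) :
    \int[P]_v \int[power_prob mu n]_t F (tuple_cons (h v, t)) =
    \int[power_prob mu n]_t F (tuple_cons (point, t)).
  rewrite (eq_integral (cst (\int[power_prob mu n]_t F (tuple_cons (point, t))))).
    exact: integral_prob_cst.
  by move=> v _; exact: Fc.
by rewrite !Ic.
Qed.

(** If the two projections of Z are independent with laws mu and nu, so are the
tuples of projections of n independent points of Z. This exchanges the order
of the two powers in (T^k)^V and T^V x ... x T^V without a change of variables. *)
Lemma integral_power_coupling n (F : n.-tuple T -> \bar R)
    (G : n.-tuple U -> \bar R) :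
  (forall (f : T -> \bar R) (g : U -> \bar R),
    measurable_fun setT f -> measurable_fun setT g ->
    (forall x, 0 <= f x) -> (forall y, 0 <= g y) ->
    \int[la]_z (f (a z) * g (b z)) = (\int[mu]_x f x) * (\int[nu]_y g y)) ->
  measurable_fun setT F -> measurable_fun setT G ->
  (forall x, 0 <= F x) -> (forall y, 0 <= G y) ->
  \int[power_prob la n]_z (F [tuple of map a z] * G [tuple of map b z]) =
  (\int[power_prob mu n]_x F x) * (\int[power_prob nu n]_y G y).
Proof.
move=> lamunu; elim: n F G => [|n IH] F G mF mG F0 G0.
  rewrite !integral_power0//; last first.
    apply: emeasurable_funM; apply: measurableT_comp => //;
    exact: measurable_map_tuple.
  by congr (F _ * G _); exact/val_inj.
rewrite !integral_powerS//; last 2 first.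
- apply: emeasurable_funM; apply: measurableT_comp => //;
    exact: measurable_map_tuple.
- by move=> z; rewrite mule_ge0.
have mcons d' (V : measurableType d') (H : n.+1.-tuple V -> \bar R) x :
    measurable_fun setT H -> measurable_fun setT (fun t => H (tuple_cons (x, t))).
  move=> mH; apply: measurableT_comp => //.
  apply: measurableT_comp; last exact: pair1_measurable.
  exact: measurable_tuple_cons.
rewrite -lamunu; last 4 first.
- apply: (measurable_fun_fubini_tonelli_F (fun p => F (tuple_cons p))) => //.
  by apply: measurableT_comp => //; exact: measurable_tuple_cons.
- apply: (measurable_fun_fubini_tonelli_F (fun p => G (tuple_cons p))) => //.
  by apply: measurableT_comp => //; exact: measurable_tuple_cons.
- by move=> x; exact: integral_ge0.
- by move=> x; exact: integral_ge0.
apply: eq_integral => z _.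
rewrite -IH; [|exact: mcons|exact: mcons|by []|by []].
by apply: eq_integral => t _; congr (F _ * G _); exact/val_inj.
Qed.

End couplings.

Section restriction_integral.
Local Open Scope ereal_scope.
Context d (T : measurableType d) (R : realType) (mu : probability T R).
Context (S : set T) (mS : measurable S) (S_gt0 : 0 < mu S).
Let S0 := pos_measure_neq0 S_gt0.

Lemma integral_restr (f : T -> \bar R) :
  measurable_fun setT f -> (forall x, 0 <= f x) ->
  \int[restr_prob mu mS S_gt0]_z f (subset_val S0 z) =
  ((fine (mu S))^-1)%:E * \int[mu]_(x in S) f x.
Proof.
move=> mf f0.
have i0 : (0 <= (fine (mu S))^-1)%R by rewrite invr_ge0 fine_ge0.
have mfS : measurable_fun S f by exact: measurable_funTS.
rewrite -(ge0_integral_mscale mu mS (NngNum i0))//=; last first.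
have valS (z : subset_space S0) : S (subset_val S0 z).
  exact: set_mem (svalP z).
transitivity
    (\int[pushforward (restr_prob mu mS S_gt0) (subset_val S0)]_(y in S) f y).
  rewrite ge0_integral_pushforward//; last exact: subset_val_measurable.
  by congr (integral _ _ _); apply/seteqP; split => z //= _; exact: valS.
apply: eq_measure_integral; first exact: subset_val_measurable.
move=> mval A mA AS.
rewrite /= /mscale/= /pushforward /restr_prob /mrestr muleC; congr (_ * mu _).
apply/seteqP; split => [_ [[z Az <-] _]//|x Ax].
split; last exact: AS.
by exists (exist (fun x => x \in S) x (mem_set (AS _ Ax))).
Qed.

End restriction_integral.

(** * Non-isolated vertices of a graph that is not a matching *)

Definition nonisolated (H : sgraph) : {set vertex H} :=
  [set u | [exists v, adj u v]]%SET.

(** The map sending an edge and a choice of one of its ends to that end is onto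
the non-isolated vertices; if there are at least 2e of these then it is
injective, so the edges are pairwise disjoint. *)
Lemma nonisolated_lt_edges (H : sgraph) : ~ is_matching H ->
  (#|nonisolated H| < 2 * #|edges H|)%N.
Proof.
move=> Hmatch; rewrite ltnNge; apply/negP => le_edges; apply: Hmatch.
pose endpoint (q : (vertex H * vertex H) * bool) := if q.2 then q.1.2 else q.1.1.
pose D := finset.setX (edges H) [set: bool]%SET.
have endpointD : nonisolated H \subset (endpoint @: D)%SET.
  apply/fintype.subsetP => u; rewrite inE => /existsP[v uv].
  case: (ltngtP (enum_rank u) (enum_rank v)) => [ltuv|ltvu|].
  - by apply/imsetP; exists ((u, v), false); rewrite ?inE//= uv ltuv.
  - by apply/imsetP; exists ((v, u), true); rewrite ?inE//= adj_sym uv ltvu.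
  - by move=> /val_inj/enum_rank_inj equv; rewrite equv adj_irr in uv.
have cardD : #|D| = (2 * #|edges H|)%N.
  by rewrite cardsX cardsT card_bool mulnC.
have inj_endpoint : {in D &, injective endpoint}.
  apply/imset_injP; rewrite eqn_leq leq_imset_card cardD.
  exact: leq_trans le_edges (subset_leq_card endpointD).
have inD (i : 'I_#|edges H|) b : (enum_val i, b) \in D.
  by rewrite !inE andbT; have := enum_valP i; rewrite inE.
exists #|edges H|, (fun q => endpoint (enum_val q.1, q.2)); split.
  move=> [i b] [j c] /inj_endpoint => /(_ (inD i b) (inD j c)) [ij ->].
  by rewrite (enum_val_inj ij).
have edgeP (p : vertex H * vertex H) : p \in edges H ->
    exists i : 'I_#|edges H|, enum_val i = p.
  by move=> pH; exists (enum_rank_in pH p); rewrite enum_rankK_in.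
move=> u v; split.
  move=> uv; case: (ltngtP (enum_rank u) (enum_rank v)) => [ltuv|ltvu|].
  - have [|i ip] := edgeP (u, v); first by rewrite inE /= uv ltuv.
    by exists i, false; rewrite /endpoint /= ip.
  - have [|i ip] := edgeP (v, u); first by rewrite inE /= adj_sym uv ltvu.
    by exists i, true; rewrite /endpoint /= ip.
  - by move=> /val_inj/enum_rank_inj equv; rewrite equv adj_irr in uv.
move=> [i [b [-> ->]]]; have := enum_valP i; rewrite inE => /andP[adji _].
by case: b; rewrite /endpoint //= adj_sym.
Qed.

(** * Densities of tensor powers *)

Section unit_interval_integral.
Context d (T : measurableType d) (R : realType) (P : probability T R).
Context (f : T -> R) (mf : measurable_fun setT f).
Hypothesis f01 : forall x, 0 <= f x <= 1.

Lemma integral_prob_itv : (0 <= \int[P]_x (f x)%:E <= 1)%E.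
Proof.
have f0 x : setT x -> (0 <= (f x)%:E)%E.
  by move=> _; rewrite lee_fin; case/andP: (f01 x).
rewrite integral_ge0//= -[leRHS](integral_prob_cst P).
apply: ge0_le_integral => //; first exact/measurable_EFinP.
by move=> x _; rewrite lee_fin; case/andP: (f01 x).
Qed.

Lemma EFin_Rintegral_prob : (\int[P]_x f x)%:E = (\int[P]_x (f x)%:E)%E.
Proof.
rewrite /Rintegral fineK// fin_numElt; have /andP[I0 I1] := integral_prob_itv.
by rewrite (lt_le_trans (ltNyr 0) I0) (le_lt_trans I1 (ltry 1)).
Qed.

Lemma Rintegral_prob_itv : 0 <= \int[P]_x f x <= 1.
Proof. by rewrite -!lee_fin EFin_Rintegral_prob integral_prob_itv. Qed.

End unit_interval_integral.

Section densities.
Context (R : realType).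
Implicit Types (W : pregraphon R) (H : sgraph).

Lemma gfun_measurable_section W (x : gspace W) :
  measurable_fun setT (fun y => W (x, y)).
Proof. by apply: (measurableT_comp (@gfun_measurable _ W)). Qed.

Lemma EFin_degree W (x : gspace W) :
  (degree x)%:E = (\int[gmu W]_y (W (x, y))%:E)%E.
Proof.
apply: EFin_Rintegral_prob; first exact: gfun_measurable_section.
by move=> y; exact: gfun_itv.
Qed.

Lemma degree_itv W (x : gspace W) : 0 <= degree x <= 1.
Proof.
apply: Rintegral_prob_itv; first exact: gfun_measurable_section.
by move=> y; exact: gfun_itv.
Qed.

Lemma degree_ge0 W (x : gspace W) : 0 <= degree x.
Proof. by case/andP: (degree_itv x). Qed.

Lemma degree_measurable W : measurable_fun setT (@degree R W).
Proof.
apply/measurable_EFinP.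
rewrite (_ : _ \o _ = fun x => \int[gmu W]_y (W (x, y))%:E)%E; last first.
  by apply/funext => x /=; rewrite EFin_degree.
apply: (measurable_fun_fubini_tonelli_F (fun z => (W z)%:E)).
  by apply/measurable_EFinP; exact: gfun_measurable.
by move=> z; rewrite lee_fin; case/andP: (gfun_itv z).
Qed.

Lemma EFin_edge_density W :
  (edge_density W)%:E = (\int[(gmu W \x gmu W)%E]_z (W z)%:E)%E.
Proof.
apply: (EFin_Rintegral_prob (gmu W \x gmu W)%E).
- exact: gfun_measurable.
- by move=> y; exact: gfun_itv.
Qed.

Lemma edge_density_degree W :
  (edge_density W)%:E = (\int[gmu W]_x (degree x)%:E)%E.
Proof.
rewrite EFin_edge_density fubini_tonelli1.
- by apply: eq_integral => x _; rewrite EFin_degree.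
- by apply/measurable_EFinP; exact: gfun_measurable.
- by move=> z; rewrite lee_fin; case/andP: (gfun_itv z).
Qed.

Lemma edge_density_itv W : 0 <= edge_density W <= 1.
Proof.
apply: (Rintegral_prob_itv (gmu W \x gmu W)%E).
- exact: gfun_measurable.
- by move=> y; exact: gfun_itv.
Qed.

Lemma edge_density_ge0 W : 0 <= edge_density W.
Proof. by case/andP: (edge_density_itv W). Qed.

Definition hom_weight H W (x : #|vertex H|.-tuple (gspace W)) : R :=
  \prod_(p in edges H) W (tnth x (enum_rank p.1), tnth x (enum_rank p.2)).

Lemma hom_weight_measurable H W : measurable_fun setT (@hom_weight H W).
Proof.
rewrite (_ : @hom_weight H W = fun x => \prod_(p <- enum (edges H))
    W (tnth x (enum_rank p.1), tnth x (enum_rank p.2))); last first.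
  by apply/funext => x; rewrite big_enum.
apply: measurable_prod => p _.
apply: measurableT_comp; first exact: gfun_measurable.
by apply: measurable_fun_pair; exact: measurable_tnth.
Qed.

Lemma hom_weight_itv H W x : 0 <= @hom_weight H W x <= 1.
Proof.
apply/andP; split.
  apply: prodr_ge0 => p _.
  by case/andP: (gfun_itv (tnth x (enum_rank p.1), tnth x (enum_rank p.2))).
by apply: prodr_ile1 => r _; exact: gfun_itv.
Qed.

Lemma hom_weight_ge0 H W x : (0 <= (@hom_weight H W x)%:E)%E.
Proof. by rewrite lee_fin; case/andP: (hom_weight_itv x). Qed.

Lemma EFin_hom_density H W :
  (hom_density H W)%:E =
  (\int[power_prob (gmu W) #|vertex H|]_x (hom_weight x)%:E)%E.
Proof.
apply: EFin_Rintegral_prob; first exact: hom_weight_measurable.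
exact: hom_weight_itv.
Qed.

Lemma hom_density_ge0 H W : 0 <= hom_density H W.
Proof.
rewrite -lee_fin EFin_hom_density; apply: integral_ge0 => x _.
exact: hom_weight_ge0.
Qed.

Lemma hom_weight_nonisolated H W :
  depends_only_on (enum_rank @: nonisolated H)%SET
    (fun x => (@hom_weight H W x)%:E).
Proof.
move=> x y xy; congr (_%:E); apply: eq_bigr => p; rewrite inE => /andP[padj _].
congr (W (_, _)); apply: xy; rewrite mem_imset ?inE; try exact: enum_rank_inj.
  by apply/existsP; exists p.2.
by apply/existsP; exists p.1; rewrite adj_sym.
Qed.

Lemma degree_tensor W k (x : gspace (tensor_power W k)) :
  degree x = \prod_(r < k) degree (tnth x r).
Proof.
apply: EFin_inj; rewrite EFin_degree.
rewrite -(integral_power_prod (mu := gmu W) (g := fun r y => W (tnth x r, y)))//.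
- by move=> r; exact: gfun_measurable_section.
- by move=> r y; case/andP: (gfun_itv (tnth x r, y)).
- by move=> r; rewrite EFin_degree.
Qed.

Lemma edge_density_tensor W k :
  edge_density (tensor_power W k) = edge_density W ^+ k.
Proof.
apply: EFin_inj; rewrite edge_density_degree.
under eq_integral do rewrite degree_tensor.
rewrite (integral_power_prod (mu := gmu W) (g := fun=> @degree R W)
  (r := fun=> edge_density W)) ?prodr_const ?card_ord//.
- by move=> _; exact: degree_measurable.
- by move=> _ x; exact: degree_ge0.
- by move=> _; rewrite edge_density_degree.
Qed.

(** The weight of a k.+1-st tensor power factors through the first coordinates
and the remaining ones; [integral_power_coupling] then separates the two
factors. *)
Lemma hom_weight_tensorS H W k
    (z : #|vertex H|.-tuple (gspace (tensor_power W k.+1))) :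
  hom_weight z =
  hom_weight (W := W)
    [tuple of map (fun t : k.+1.-tuple (gspace W) => tnth t ord0) z] *
  hom_weight (W := tensor_power W k)
    [tuple of map (fun t : k.+1.-tuple (gspace W) => [tuple of behead t]) z].
Proof.
rewrite -big_split; apply: eq_bigr => p _ /=.
rewrite !tnth_map /tensor_fun big_ord_recl /=; congr (_ * _).
apply: eq_bigr => i _.
by congr (W (_, _)); rewrite [in LHS](tuple_eta (tnth z _)) tnthS.
Qed.

Lemma hom_density_tensor H W k :
  hom_density H (tensor_power W k) = hom_density H W ^+ k.
Proof.
elim: k => [|k IH].
  apply: EFin_inj; rewrite EFin_hom_density expr0.
  rewrite (eq_integral (cst 1%E)).
    exact: integral_prob_cst.
  move=> x _; congr (_%:E); rewrite /hom_weight big1// => p _.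
  by rewrite /= /tensor_fun big_ord0.
rewrite exprS -IH; apply: EFin_inj; rewrite EFinM !EFin_hom_density.
under eq_integral do rewrite hom_weight_tensorS EFinM.
apply: (@integral_power_coupling _ _ _ _ _ _ _ (power_prob (gmu W) k.+1)
  (gmu W) (power_prob (gmu W) k) (fun t => tnth t ord0)
  (fun t => [tuple of behead t]) _ _ _ (fun x => (hom_weight x)%:E)
  (fun x => (@hom_weight H (tensor_power W k) x)%:E)).
- exact: measurable_tnth.
- exact: measurable_behead.
- move=> f g mf mg f0 g0.
  rewrite integral_powerS; last 2 first.
  + apply: emeasurable_funM; apply: measurableT_comp => //.
      exact: measurable_tnth.
    exact: measurable_behead.
  + by move=> x; rewrite mule_ge0.
  transitivity (\int[gmu W]_x (f x * \int[power_prob (gmu W) k]_y g y))%E.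
    apply: eq_integral => x _; rewrite -ge0_integralZl//.
    apply: eq_integral => t _; congr (_ * g _)%E.
    exact: val_inj.
  by rewrite ge0_integralZr// integral_ge0.
- by apply/measurable_EFinP; exact: hom_weight_measurable.
- by apply/measurable_EFinP; exact: (@hom_weight_measurable H (tensor_power W k)).
- by move=> x; exact: hom_weight_ge0.
- by move=> x; exact: hom_weight_ge0.
Qed.

End densities.

(** * Densities of restrictions *)

Lemma integral_indicr d (T : measurableType d) (R : realType)
    (mu : {measure set T -> \bar R}) (D : set T) (f : T -> R) :
  (\int[mu]_(x in D) (f x)%:E = \int[mu]_x (f x * \1_D x)%:E)%E.
Proof.
rewrite integral_mkcond; apply: eq_integral => x _.
by rewrite patchE indicE; case: ifP => _; rewrite ?mulr1 ?mulr0.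
Qed.

Section restriction_densities.
Context (R : realType) (W : pregraphon R) (S : set (gspace W)).
Context (mS : measurable S) (S_gt0 : (0 < gmu W S)%E).

Let S0 := pos_measure_neq0 S_gt0.
Let alpha : R := fine (gmu W S).

Lemma mass_itv : 0 < alpha <= 1.
Proof.
have fS : gmu W S \is a fin_num by exact: fin_num_measure.
rewrite -!lte_fin -lee_fin /alpha fineK// S_gt0 /=.
exact: probability_le1.
Qed.

(** The normalized restriction of mu is at most alpha^-1 mu, and the weight of H
ignores the positions of the isolated vertices. *)
Lemma hom_density_restriction H :
  hom_density H (restriction mS S_gt0) <=
  alpha^-1 ^+ #|nonisolated H| * hom_density H W.
Proof.
rewrite -lee_fin EFinM !EFin_hom_density.
rewrite -(card_imset _ (@enum_rank_inj (vertex H))).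
rewrite (eq_integral (fun z : #|vertex H|.-tuple
  (gspace (restriction mS S_gt0)) =>
  (@hom_weight R H W [tuple of map (subset_val S0) z])%:E)); last first.
  move=> z _; congr (_%:E); apply: eq_bigr => p _.
  by rewrite /= /restriction_fun /= !tnth_map.
apply: (@integral_power_dominated _ _ _ _ _ (restr_prob (gmu W) mS S_gt0)
  (gmu W) (subset_val S0) _ _ _ _ (fun x => (@hom_weight R H W x)%:E)).
- exact: subset_val_measurable.
- by rewrite invr_ge0 ltW//; case/andP: mass_itv.
- move=> f mf f0; rewrite integral_restr//.
  rewrite lee_wpmul2l ?lee_fin ?invr_ge0 ?fine_ge0//.
  by apply: ge0_subset_integral => //.
- by apply/measurable_EFinP; exact: hom_weight_measurable.
- by move=> x; exact: hom_weight_ge0.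
- exact: hom_weight_nonisolated.
Qed.

Let W0 z : (0 <= (W z)%:E)%E.
Proof. by rewrite lee_fin; case/andP: (gfun_itv z). Qed.

Let partial_degree_ge0 D x : (0 <= \int[gmu W]_(y in D) (W (x, y))%:E)%E.
Proof. by apply: integral_ge0 => y _; exact: W0. Qed.

Lemma measurable_partial_degree (D : set (gspace W)) : measurable D ->
  measurable_fun setT (fun x => \int[gmu W]_(y in D) (W (x, y))%:E)%E.
Proof.
move=> mD; under eq_fun do rewrite integral_indicr.
apply: (measurable_fun_fubini_tonelli_F (fun z => (W z * \1_D z.2)%:E)).
  apply/measurable_EFinP; apply: measurable_funM; first exact: gfun_measurable.
  by apply: measurableT_comp => //; exact: measurable_indic.
by move=> z; rewrite lee_fin mulr_ge0//; have := W0 z; rewrite lee_fin.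
Qed.

Lemma edge_density_restriction :
  (alpha ^+ 2 * edge_density (restriction mS S_gt0))%:E =
  (\int[gmu W]_(x in S) \int[gmu W]_(y in S) (W (x, y))%:E)%E.
Proof.
have [alpha0 _] := andP mass_itv.
have ai0 : (0 <= (alpha^-1)%:E)%E by rewrite lee_fin invr_ge0 ltW.
rewrite EFinM EFin_edge_density fubini_tonelli1; last 2 first.
- by apply/measurable_EFinP; exact: gfun_measurable.
- by move=> z; rewrite lee_fin; case/andP: (gfun_itv z).
rewrite /fubini_F.
rewrite (eq_integral (fun x : gspace (restriction mS S_gt0) =>
  ((alpha^-1)%:E * \int[gmu W]_(y in S) (W (subset_val S0 x, y))%:E)%E));
  last first.
  move=> x _.
  apply: (integral_restr mS S_gt0 (f := fun y => (W (subset_val S0 x, y))%:E)).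
    by apply/measurable_EFinP; exact: gfun_measurable_section.
  by move=> y; exact: W0.
rewrite (integral_restr mS S_gt0 (f := fun x =>
  ((alpha^-1)%:E * \int[gmu W]_(y in S) (W (x, y))%:E)%E)); last 2 first.
- by apply: measurable_funeM; exact: measurable_partial_degree.
- by move=> x; rewrite mule_ge0.
rewrite ge0_integralZl//; last first.
  by apply: measurable_funTS; exact: measurable_partial_degree.
rewrite !muleA -!EFinM expr2 -/alpha mulfK ?gt_eqF// mulfV ?gt_eqF//.
by rewrite mul1e.
Qed.

(** The square of the space is covered by S x S and the two strips over the
complement of S, and each strip carries the mass of the degree outside S. *)
Lemma edge_density_le_restriction (delta : R) :
  (\int[gmu W]_(x in ~` S) (degree x)%:E = delta%:E)%E ->
  edge_density W <=
  alpha ^+ 2 * edge_density (restriction mS S_gt0) + delta + delta.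
Proof.
move=> deltaE; rewrite -lee_fin !EFinD edge_density_restriction -deltaE.
have mSC : measurable (~` S) by exact: measurableC.
have split_integral (f : gspace W -> \bar R) : measurable_fun setT f ->
    (forall x, 0 <= f x)%E -> (\int[gmu W]_x f x =
    \int[gmu W]_(x in S) f x + \int[gmu W]_(x in ~` S) f x)%E.
  move=> mf f0; rewrite -ge0_integral_setU ?setUv//.
  by apply/disj_set2P; rewrite setICr.
have mW x : measurable_fun setT (fun y => (W (x, y))%:E).
  by apply/measurable_EFinP; exact: gfun_measurable_section.
rewrite edge_density_degree split_integral; last 2 first.
- by apply/measurable_EFinP; exact: degree_measurable.
- by move=> x; rewrite lee_fin degree_ge0.
rewrite leeD2r//.
under eq_integral do rewrite EFin_degree split_integral//.
rewrite ge0_integralD//; last 2 first.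
- by apply: measurable_funTS; exact: measurable_partial_degree.
- by apply: measurable_funTS; exact: measurable_partial_degree.
rewrite leeD2l//.
apply: (@le_trans _ _ (\int[gmu W]_x \int[gmu W]_(y in ~` S) (W (x, y))%:E)%E).
  by apply: ge0_subset_integral => //; exact: measurable_partial_degree.
under eq_integral do rewrite integral_indicr.
rewrite (fubini_tonelli (fun z => (W z * \1_(~` S) z.2)%:E)); last 2 first.
- apply/measurable_EFinP; apply: measurable_funM; first exact: gfun_measurable.
  by apply: measurableT_comp => //; exact: measurable_indic.
- by move=> z; rewrite lee_fin mulr_ge0//; have := W0 z; rewrite lee_fin.
rewrite integral_indicr le_eqVlt; apply/orP; left; apply/eqP.
apply: eq_integral => y _ /=.
rewrite mulrC EFinM EFin_degree -ge0_integralZl ?lee_fin//.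
by apply: eq_integral => x _; rewrite -EFinM mulrC gfun_sym.
Qed.

End restriction_densities.

(** * The Hellinger affinity of the degree *)

Section affinity.
Context (R : realType).
Implicit Types (W : pregraphon R) (H : sgraph).

Definition root_degree W (x : gspace W) : R :=
  Num.sqrt (edge_density W * degree x).

(** This is p times the Hellinger affinity of mu and of (deg / p) mu; keeping
the factor p avoids dividing when p = 0. *)
Definition affinity W : R := \int[gmu W]_x root_degree x.

Lemma root_degree_itv W (x : gspace W) : 0 <= root_degree x <= 1.
Proof.
rewrite sqrtr_ge0 -sqrtr1 ler_sqrt ?ltr01// mulr_ile1 ?edge_density_ge0//.
- exact: degree_ge0.
- by case/andP: (edge_density_itv W).
- by case/andP: (degree_itv x).
Qed.

Lemma root_degree_measurable W : measurable_fun setT (@root_degree W).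
Proof.
apply: (measurableT_comp (f := @Num.sqrt R)).
  by apply: continuous_measurable_fun; exact: sqrt_continuous.
by apply: measurable_funM => //; exact: degree_measurable.
Qed.

Lemma EFin_affinity W :
  (affinity W)%:E = (\int[gmu W]_x (root_degree x)%:E)%E.
Proof.
apply: EFin_Rintegral_prob; first exact: root_degree_measurable.
exact: root_degree_itv.
Qed.

Lemma affinity_ge0 W : 0 <= affinity W.
Proof.
rewrite -lee_fin EFin_affinity; apply: integral_ge0 => x _.
by rewrite lee_fin sqrtr_ge0.
Qed.

Lemma root_degree_tensor W k (x : gspace (tensor_power W k)) :
  root_degree x = \prod_(r < k) root_degree (tnth x r).
Proof.
rewrite /root_degree edge_density_tensor degree_tensor.
rewrite -[k in _ ^+ k]card_ord -prodr_const -big_split /=.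
have p0 r : 0 <= edge_density W * degree (tnth x r).
  by rewrite mulr_ge0 ?edge_density_ge0 ?degree_ge0.
pose P (a b : R) := 0 <= a /\ Num.sqrt a = b.
suff [] : P (\prod_(r < k) (edge_density W * degree (tnth x r)))
  (\prod_(r < k) Num.sqrt (edge_density W * degree (tnth x r))) by [].
apply: big_rec2; first by rewrite /P sqrtr1.
by move=> r a b _ [a0 ab]; rewrite /P mulr_ge0// sqrtrM// ab.
Qed.

Lemma affinity_tensor W k : affinity (tensor_power W k) = affinity W ^+ k.
Proof.
apply: EFin_inj; rewrite EFin_affinity.
under eq_integral do rewrite root_degree_tensor.
rewrite (integral_power_prod (mu := gmu W) (g := fun=> @root_degree W)
  (r := fun=> affinity W)) ?prodr_const ?card_ord//.
- by move=> _; exact: root_degree_measurable.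
- by move=> _ x; exact: sqrtr_ge0.
- by move=> _; rewrite EFin_affinity.
Qed.

(** Equality case of the inequality between the affinity and p: the integral of
(sqrt deg - sqrt p)^2 is 2p minus twice the affinity. *)
Lemma regular_of_affinity W : edge_density W <= affinity W -> regular W.
Proof.
move=> pQ; set p := edge_density W.
have p0 : 0 <= p := edge_density_ge0 W.
pose f (x : gspace W) : R := (Num.sqrt (degree x) - Num.sqrt p) ^+ 2.
have f0 x : (0 <= (f x)%:E)%E by rewrite lee_fin sqr_ge0.
have mf : measurable_fun setT (EFin \o f).
  apply/measurable_EFinP; apply: measurable_funX; apply: measurable_funB => //.
  apply: (measurableT_comp (f := @Num.sqrt R)); last exact: degree_measurable.
  by apply: continuous_measurable_fun; exact: sqrt_continuous.
have mroot : measurable_fun setT (fun x => (@root_degree W x)%:E).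
  by apply/measurable_EFinP; exact: root_degree_measurable.
have root0 x : (0 <= (@root_degree W x)%:E)%E by rewrite lee_fin sqrtr_ge0.
(* (sqrt deg - sqrt p)^2 + 2 sqrt (p deg) = deg + p, integrated. *)
have fE : (\int[gmu W]_x (f x)%:E + (affinity W + affinity W)%:E = (p + p)%:E)%E.
  rewrite EFinD EFin_affinity -!ge0_integralD//; last 2 first.
  - by move=> x _; rewrite adde_ge0.
  - exact: emeasurable_funD.
  transitivity (\int[gmu W]_x ((degree x)%:E + (cst p%:E) x))%E.
    apply: eq_integral => x _; rewrite -!EFinD; congr (_%:E).
    have d0 := degree_ge0 x.
    rewrite /f /root_degree sqrrB !sqr_sqrtr// sqrtrM// mulr2n.
    rewrite (mulrC (Num.sqrt (edge_density W))) -/p; lra.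
  rewrite ge0_integralD//.
  - by rewrite -edge_density_degree integral_prob_cst EFinD.
  - by move=> x _; rewrite lee_fin degree_ge0.
  - by apply/measurable_EFinP; exact: degree_measurable.
have If0 : (\int[gmu W]_x `|(f x)%:E| = 0)%E.
  under eq_integral do rewrite gee0_abs//.
  apply/eqP; rewrite eq_le integral_ge0// andbT.
  rewrite -(@leeD2rE _ (affinity W + affinity W)%:E)// fE add0e lee_fin.
  by rewrite lerD.
have /ae_eq_integral_abs := If0 => /(_ measurableT mf).
apply: filterS => x /(_ I) /= [] /eqP.
rewrite sqrf_eq0 subr_eq0 => /eqP sqrtE.
by rewrite -[LHS]sqr_sqrtr ?degree_ge0// sqrtE sqr_sqrtr.
Qed.

(** The set S of vertices of degree at least p is the one on which (deg / p) mu
dominates mu; since sqrt (p deg) is at least min p deg, both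
alpha p and the mass of the degree outside S are at most the affinity. The
Sidorenko inequality on W[S] then gives
(p - 2Q)^e <= alpha^(2e - v) t(H, W) <= alpha t(H, W). *)
Lemma affinity_bound W H : (#|nonisolated H| < 2 * #|edges H|)%N ->
  0 < edge_density W -> 2 * affinity W < edge_density W ->
  (forall (S : set (gspace W)) (mS : measurable S) (S_gt0 : (0 < gmu W S)%E),
    edge_density (restriction mS S_gt0) ^+ #|edges H| <=
    hom_density H (restriction mS S_gt0)) ->
  edge_density W * (edge_density W - 2 * affinity W) ^+ #|edges H| <=
  affinity W * hom_density H W.
Proof.
set p := edge_density W; set Q := affinity W => vlt2e p0 Qp sid.
pose S := [set x : gspace W | p <= degree x].
have mS : measurable S.
  rewrite (_ : S = (@degree R W) @^-1` `[p, +oo[%classic).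
    by rewrite -[X in measurable X]setTI; exact: degree_measurable.
  by apply/seteqP; split => x /=; rewrite in_itv/= andbT.
pose delta : R := \int[gmu W]_x (degree x * \1_(~` S) x).
have ind01 (D : set (gspace W)) x : 0 <= (\1_D x : R) <= 1.
  by rewrite indicE; case: (x \in D); rewrite /= ?lexx ?ler01.
have mdegSC : measurable_fun setT (fun x => degree x * \1_(~` S) x : R).
  apply: measurable_funM; first exact: degree_measurable.
  by apply: measurable_indic; exact: measurableC.
have deltaE : (\int[gmu W]_(x in ~` S) (degree x)%:E = delta%:E)%E.
  rewrite integral_indicr /delta EFin_Rintegral_prob//.
  move=> x; have /andP[d0 d1] := degree_itv x.
  have /andP[i0 i1] := ind01 (~` S) x.
  by rewrite mulr_ge0//= mulr_ile1.
have deltaQ : delta <= Q.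
  rewrite -lee_fin -deltaE integral_indicr EFin_affinity.
  apply: ge0_le_integral => //.
  - by move=> x _; rewrite lee_fin mulr_ge0 ?degree_ge0.
  - by apply/measurable_EFinP; exact: mdegSC.
  - by apply/measurable_EFinP; exact: root_degree_measurable.
  - move=> x _; rewrite lee_fin indicE.
    have [|_] := boolP (x \in ~` S); last by rewrite mulr0 sqrtr_ge0.
    rewrite inE /= => /negP; rewrite -ltNge => dp; rewrite mulr1.
    have d0 := degree_ge0 x.
    rewrite -[leLHS](ger0_norm d0) -sqrtr_sqr ler_wsqrtr// expr2 ler_wpM2r//.
    exact: ltW.
have [alpha_fin alpha0] : gmu W S \is a fin_num /\ 0 <= fine (gmu W S).
  by rewrite fin_num_measure ?fine_ge0.
have alphaQ : fine (gmu W S) * p <= Q.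
  have -> : fine (gmu W S) * p = fine (\int[gmu W]_(x in S) (cst p%:E x))%E.
    by rewrite (integral_cst (gmu W) mS) mulrC fineM.
  rewrite -lee_fin fineK; last by rewrite (integral_cst (gmu W) mS) fin_numM.
  rewrite [leLHS](integral_indicr _ _ (fun=> p)) EFin_affinity.
  apply: ge0_le_integral => //.
  - by move=> x _; rewrite lee_fin mulr_ge0 ?(ltW p0).
  - by apply/measurable_EFinP; exact: measurable_funM.
  - by apply/measurable_EFinP; exact: root_degree_measurable.
  - move=> x _; rewrite lee_fin indicE.
    have [|_] := boolP (x \in S); last by rewrite mulr0 sqrtr_ge0.
    rewrite inE /= mulr1 => pd.
    rewrite -[leLHS](ger0_norm (ltW p0)) -sqrtr_sqr ler_wsqrtr// expr2.
    by rewrite ler_wpM2l// ltW.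
have S_gt0 : (0 < gmu W S)%E.
  rewrite lt0e measure_ge0 andbT; apply/eqP => S0.
  have pdelta : p <= delta.
    rewrite -lee_fin -deltaE edge_density_degree.
    rewrite (ge0_negligible_integral mS _ _ _ S0)//; last 2 first.
    - by apply/measurable_EFinP; exact: degree_measurable.
    - by move=> x _; rewrite lee_fin degree_ge0.
    by rewrite setTD.
  have Q0 : 0 <= Q := affinity_ge0 W.
  have pQ := le_trans pdelta deltaQ.
  by suff: False by []; lra.
set alpha := fine (gmu W S) in alpha0 alphaQ.
have /andP[a0 a1] : 0 < alpha <= 1 := mass_itv mS S_gt0.
set e := #|edges H| in vlt2e *; set v := #|nonisolated H| in vlt2e.
set P' := edge_density (restriction mS S_gt0).
have base : p - 2 * Q <= alpha ^+ 2 * P'.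
  have := edge_density_le_restriction mS S_gt0 deltaE; rewrite -/p -/P' -/alpha.
  lra.
have P'0 : 0 <= P' := edge_density_ge0 _.
have t0 : 0 <= hom_density H W := hom_density_ge0 H W.
(* Here v < 2e is used: a positive power of alpha is left. *)
have power_bound : (p - 2 * Q) ^+ e <= alpha * hom_density H W.
  apply: (@le_trans _ _ ((alpha ^+ 2 * P') ^+ e)).
    by rewrite lerXn2r ?nnegrE ?mulr_ge0 ?exprn_ge0//; lra.
  rewrite exprMn -exprM.
  apply: (@le_trans _ _ (alpha ^+ (2 * e) * (alpha^-1 ^+ v * hom_density H W))).
    rewrite ler_wpM2l ?exprn_ge0//.
    exact: le_trans (sid S mS S_gt0) (hom_density_restriction mS S_gt0 H).
  rewrite mulrA ler_wpM2r// exprVn.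
  rewrite -(subnK (ltnW vlt2e)) exprD mulfK ?expf_neq0 ?gt_eqF//.
  have := subn_gt0 v (2 * e)%N; rewrite vlt2e.
  case: (2 * e - v)%N => // n _; rewrite exprS ler_piMr//.
  by rewrite exprn_ile1.
apply: (@le_trans _ _ (p * (alpha * hom_density H W))).
  by rewrite ler_wpM2l// ltW.
by rewrite mulrA (mulrC p) ler_wpM2r.
Qed.

(** With r = (Q / p)^k, the bound for the k-th tensor power reads
(1 - 2r)^e <= r, which is absurd once r is small. *)
Lemma sidorenko_equality_regular W H :
  (#|nonisolated H| < 2 * #|edges H|)%N ->
  (forall k (S : set (gspace (tensor_power W k.+1))) (mS : measurable S)
    (S_gt0 : (0 < gmu (tensor_power W k.+1) S)%E),
    edge_density (restriction mS S_gt0) ^+ #|edges H| <=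
    hom_density H (restriction mS S_gt0)) ->
  hom_density H W = edge_density W ^+ #|edges H| -> regular W.
Proof.
move=> vlt2e sid tE; apply: regular_of_affinity; rewrite leNgt; apply/negP => Qp.
set p := edge_density W in Qp tE *; set Q := affinity W in Qp *.
have Q0 : 0 <= Q := affinity_ge0 W.
have p0 : 0 < p by exact: le_lt_trans Qp.
set e := #|edges H| in vlt2e tE.
pose rho := Q / p.
have rho0 : 0 <= rho by rewrite divr_ge0// ltW.
have rho1 : rho < 1 by rewrite ltr_pdivrMr// mul1r.
have QE : Q = rho * p by rewrite mulfVK// gt_eqF.
(* Small enough for r < eps to give both r <= 1/4 and r < 2^-e, whereas the
   bound yields 2^-e <= (1 - 2r)^e <= r. *)
pose eps : R := 2^-1 ^+ e.+2.
have eps0 : 0 < eps by rewrite exprn_gt0.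
have [k rhok] : exists k, rho ^+ k.+1 < eps.
  have : `|rho| < 1 by rewrite ger0_norm.
  move=> /cvg_expr /cvgrPdist_lt /(_ eps eps0) [N _ /(_ N.+1 (leqnSn N))] /=.
  by rewrite sub0r normrN ger0_norm ?exprn_ge0//; exists N.
have half_ge0 : 0 <= 2^-1 :> R by [].
have half_le1 : 2^-1 <= 1 :> R by rewrite invf_le1// ler1n.
have eps4 : eps <= 4^-1.
  by rewrite /eps !exprS; have := exprn_ile1 e half_ge0 half_le1; lra.
set r := rho ^+ k.+1 in rhok.
have r0 : 0 <= r by rewrite exprn_ge0.
set pk := p ^+ k.+1.
have pk0 : 0 < pk by rewrite exprn_gt0.
have := @affinity_bound (tensor_power W k.+1) H vlt2e.
rewrite edge_density_tensor affinity_tensor hom_density_tensor -/p -/Q QE exprMn.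
rewrite -/r -/pk => /(_ pk0).
have -> : 2 * (r * pk) < pk by rewrite mulrA gtr_pMl//; lra.
move=> /(_ isT (sid k)); rewrite -/e tE -/p -exprM mulnC exprM -/pk.
rewrite (_ : pk - 2 * (r * pk) = (1 - 2 * r) * pk); last by lra.
rewrite exprMn mulrCA [leRHS](_ : _ = r * (pk * pk ^+ e)); last by rewrite mulrA.
have pke0 : 0 < pk * pk ^+ e by rewrite mulr_gt0// exprn_gt0.
rewrite ler_pM2r// leNgt => /negP; apply.
apply: (lt_le_trans rhok); apply: (@le_trans _ _ (2^-1 ^+ e)).
  by rewrite /eps !exprS; have := exprn_ge0 e half_ge0; lra.
by rewrite lerXn2r ?nnegrE//; lra.
Qed.

End affinity.

(** * Graphons are closed under tensor powers and restrictions *)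

Section ternary.
Context (R : realType).
Implicit Types (b : nat -> bool) (z : R).

Definition bit_tail b : nat -> bool := fun n => b n.+1.

Fixpoint ternary_sum n b : R :=
  if n is n'.+1 then ((if b 0%N then 2 else 0) + ternary_sum n' (bit_tail b)) / 3
  else 0.

Definition ternary b : R := limn (ternary_sum ^~ b).

(** Among the numbers with ternary digits 0 and 2, those that start with 0 are at
most 1/3 and those that start with 2 are at least 2/3: the cutoff 1/2 tells them
apart, and no number has two such expansions. *)
Fixpoint ternary_digit n z : bool :=
  if n is n'.+1 then ternary_digit n' (3 * z - (if 2^-1 < z then 2 else 0))
  else 2^-1 < z.

Lemma ternary_sum_itv n b : 0 <= ternary_sum n b <= 1.
Proof.
elim: n b => [|n IH] b /=; first by rewrite lexx ler01.
by have /andP[h0 h1] := IH (bit_tail b); case: (b 0%N); apply/andP; split; lra.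
Qed.

Lemma ternary_sum_nondecreasing b : nondecreasing_seq (ternary_sum ^~ b).
Proof.
apply/nondecreasing_seqP => n; elim: n b => [|n IH] b /=.
  by have /andP[] := ternary_sum_itv 1 b.
by have := IH (bit_tail b) => /=; case: (b 0%N) => ?; lra.
Qed.

Lemma ternary_cvg b : ternary_sum ^~ b @ \oo --> ternary b.
Proof.
apply: nondecreasing_is_cvgn; first exact: ternary_sum_nondecreasing.
by exists 1 => _ [n _ <-]; have /andP[] := ternary_sum_itv n b.
Qed.

Lemma ternary_itv b : 0 <= ternary b <= 1.
Proof.
apply/andP; split.
  apply: limr_ge; first exact: ternary_cvg.
  by near=> n; have /andP[] := ternary_sum_itv n b.
apply: limr_le; first exact: ternary_cvg.
by near=> n; have /andP[] := ternary_sum_itv n b.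
Unshelve. all: by end_near. Qed.

Lemma ternary_tail b :
  ternary b = ((if b 0%N then 2 else 0) + ternary (bit_tail b)) / 3.
Proof.
have shift_cvg : (fun n => ternary_sum n.+1 b) @ \oo --> ternary b.
  by rewrite (cvg_shiftS (ternary_sum ^~ b)); exact: ternary_cvg.
apply: (cvg_unique _ shift_cvg) => //=.
by apply: cvgMr_tmp; apply: cvgD; [exact: cvg_cst|exact: ternary_cvg].
Qed.

Lemma ternaryK n b : ternary_digit n (ternary b) = b n.
Proof.
have first_digit c : (2^-1 < ternary c) = c 0%N.
  rewrite ternary_tail; have /andP[h0 h1] := ternary_itv (bit_tail c).
  case: (c 0%N); first by apply/idP; lra.
  by apply/negbTE; rewrite -leNgt; lra.
elim: n b => [|n IH] b /=; first exact: first_digit.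
rewrite first_digit -[b n.+1]/(bit_tail b n) -IH; congr (ternary_digit n _).
by rewrite (ternary_tail b); case: (b 0%N); lra.
Qed.

Lemma ternary_digit_measurable n : measurable_fun setT (ternary_digit n).
Proof.
elim: n => [|n IH] /=; first exact: measurable_fun_ltr.
apply: measurableT_comp => //; apply: measurable_funB.
  exact: measurable_funM.
by apply: measurable_fun_ifT => //; exact: measurable_fun_ltr.
Qed.

Lemma ternary_measurable d (T : measurableType d) (c : T -> nat -> bool) :
  (forall n, measurable_fun setT (c ^~ n)) ->
  measurable_fun setT (fun t => ternary (c t)).
Proof.
move=> mc; apply: (@measurable_fun_cvg _ _ _ setT
  (fun n t => ternary_sum n (c t))) => [n|t _]; last exact: ternary_cvg.
elim: n c mc => [|n IH] c mc //=; apply: measurable_funM => //.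
apply: measurable_funD; first by apply: measurable_fun_ifT.
by apply: (IH (fun t => bit_tail (c t))) => k; exact: mc.
Qed.

End ternary.

Section square_embedding.
Context (R : realType).
Implicit Types (p : R * R) (s : bool) (x z : R).

Definition side s p : R := if s then p.2 else p.1.

(** Bit number n answers whether the n-th rational lies below one of the two
coordinates; the enumeration of pairs of a rational and a side interleaves the
cuts of both coordinates. *)
Definition cut_code p (n : nat) : bool :=
  if unpickle n is Some (q, s) then ratr (q : rat) < side s p else false.

Definition pair_code p : R := ternary R (cut_code p).

(** The coordinate is the supremum of the rationals that its bits place below
it; rationals above it and indices that concern the other side count as -oo. *)
Definition cut_value s z (n : nat) : \bar R :=
  if unpickle n is Some (q, s') then
    if (s' == s) && ternary_digit n z then (ratr (q : rat))%:E else -oo%E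
  else -oo%E.

Definition decode s z : R := fine (esups (cut_value s z) 0).

Lemma pair_code_measurable : measurable_fun setT pair_code.
Proof.
apply: ternary_measurable => n; rewrite /cut_code.
case: (unpickle n) => [[q s]|]; last exact: measurable_cst.
apply: measurable_fun_ltr; first exact: measurable_cst.
by case: s; [exact: measurable_snd|exact: measurable_fst].
Qed.

Lemma decode_measurable s : measurable_fun setT (decode s).
Proof.
apply: (measurableT_comp (f := @fine R)) => //.
apply: measurable_fun_esups => n; rewrite /cut_value.
case: (unpickle n) => [[q s']|]; last exact: measurable_cst.
apply: measurable_fun_ifT => //; case: (s' == s) => //=.
exact: ternary_digit_measurable.
Qed.

Lemma pair_codeK s p : decode s (pair_code p) = side s p.
Proof.
rewrite /decode.
suff -> : esups (cut_value s (pair_code p)) 0 = (side s p)%:E by [].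
have cutE n : cut_value s (pair_code p) n =
    (if unpickle n is Some (q, s') then
      if (s' == s) && (ratr (q : rat) < side s' p) then (ratr q)%:E else -oo%E
    else -oo%E).
  by rewrite /cut_value ternaryK /cut_code; case: (unpickle n) => [[]|].
apply/eqP; rewrite eq_le; apply/andP; split.
  apply: ge_ereal_sup => _ [n _ <-]; rewrite cutE.
  case: (unpickle n) => [[q s']|]; last exact: leNye.
  by case: ifPn => [/andP[/eqP -> /ltW]|_]; rewrite ?lee_fin ?leNye.
rewrite leNgt; apply/negP => sup_lt.
have [y yx suply] : exists2 y, y < side s p &
    (esups (cut_value s (pair_code p)) 0%N <= y%:E)%E.
  move: sup_lt; case: (esups _ _) => [r||] //; first by exists r.
  by exists (side s p - 1); [lra|exact: leNye].
have [q] := rat_in_itvoo yx; rewrite in_itv/= => /andP[yq qx].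
have : ((ratr q)%:E <= y%:E :> \bar R)%E.
  apply: le_trans suply; apply: ereal_sup_ubound.
  by exists (pickle (q, s)) => //=; rewrite cutE pickleK eqxx qx.
by rewrite lee_fin leNgt yq.
Qed.

End square_embedding.

(** The image of A consists of the fixed points of f o g that g sends into A,
which is a Borel condition. *)
Lemma measurable_image_left_inverse d1 d2 (T : measurableType d1)
    (U : measurableType d2) (R : realType) (f : T -> R) (g : R -> T)
    (A : set T) :
  cancel f g -> measurable_fun setT f -> measurable_fun setT g ->
  measurable A -> measurable (f @` A).
Proof.
move=> fK mf mg mA.
rewrite (_ : f @` A = [set z | f (g z) == z] `&` g @^-1` A).
  apply: measurableI; last by rewrite -[X in measurable X]setTI; exact: mg.
  rewrite -[X in measurable X]setTI.
  by apply: (measurable_fun_eqr (measurableT_comp mf mg) _ measurableT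
    (Y := [set true])).
apply/seteqP; split => [_ [x Ax <-]|z [/= /eqP fgz Agz]].
  by rewrite /= fK eqxx.
by exists (g z).
Qed.

Section standard_borel_spaces.
Context (R : realType).

(** The left inverse is constant off the range of f, so its preimages are images
under f up to the complement of the range. *)
Lemma standard_borelP d (T : measurableType d) : standard_borel R T <->
  exists (f : T -> R) (g : R -> T),
    [/\ cancel f g, measurable_fun setT f & measurable_fun setT g].
Proof.
split=> [[f [finj mf fimg]]|[f [g [fK mf mg]]]]; last first.
  exists f; split => //; first exact: can_inj fK.
  by move=> A mA; exact: measurable_image_left_inverse fK mf mg mA.
pose g z := if pselect (exists x, f x = z) is left h then sval (cid h) else point.
have fK : cancel f g.
  move=> x; rewrite /g; case: pselect => [h|]; last by case; exists x.
  by apply: finj; exact: svalP (cid h).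
exists f, g; split => // _ B mB; rewrite setTI.
rewrite (_ : g @^-1` B = f @` B `|` (~` range f `&` [set _ | B point])).
  apply: measurableU; first exact: fimg.
  apply: measurableI; first by apply: measurableC; exact: fimg.
  have [Bp|nBp] := pselect (B point).
    by rewrite (_ : [set _ | _] = setT)//; apply/seteqP; split.
  by rewrite (_ : [set _ | _] = set0)//; apply/seteqP; split.
apply/seteqP; split => [z /= Bgz|z [[x Bx <-]|[nfz Bp]] /=].
- have [[x fx]|nfz] := pselect (exists x, f x = z).
    by left; exists x => //; rewrite -(fK x) fx.
  right; split; first by move=> [x _ fx]; apply: nfz; exists x.
  by move: Bgz; rewrite /g; case: pselect.
- by rewrite fK.
- by rewrite /g; case: pselect => // -[x fx]; case: nfz; exists x.
Qed.

Lemma standard_borel_prod d1 d2 (T : measurableType d1) (U : measurableType d2) :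
  standard_borel R T -> standard_borel R U -> standard_borel R (T * U)%type.
Proof.
move=> /standard_borelP[f1 [g1 [fK1 mf1 mg1]]].
move=> /standard_borelP[f2 [g2 [fK2 mf2 mg2]]].
apply/standard_borelP; exists (fun p => pair_code (f1 p.1, f2 p.2)).
exists (fun z => (g1 (decode false z), g2 (decode true z))); split.
- by move=> [x y]; rewrite !pair_codeK /= fK1 fK2.
- apply: (measurableT_comp (@pair_code_measurable R)).
  apply: measurable_fun_pair.
    exact: (measurableT_comp mf1 measurable_fst).
  exact: (measurableT_comp mf2 measurable_snd).
- apply: measurable_fun_pair.
    exact: (measurableT_comp mg1 (@decode_measurable R false)).
  exact: (measurableT_comp mg2 (@decode_measurable R true)).
Qed.

Lemma standard_borel_tuple d (T : measurableType d) n :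
  standard_borel R T -> standard_borel R (n.-tuple T).
Proof.
move=> sT; elim: n => [|n sTn].
  apply/standard_borelP; exists (fun=> 0), (fun=> [tuple]).
  by split => // x; rewrite [RHS]tuple0.
have /standard_borelP[f [g [fK mf mg]]] := standard_borel_prod sT sTn.
apply/standard_borelP.
exists (fun t => f (tnth t ord0, [tuple of behead t])), (@tuple_cons _ T n \o g).
split.
- by move=> t /=; rewrite fK [RHS]tuple_eta.
- apply: (measurableT_comp mf).
  apply: measurable_fun_pair; first exact: measurable_tnth.
  exact: measurable_behead.
- by apply: measurableT_comp => //; exact: measurable_tuple_cons.
Qed.

Lemma standard_borel_subset d (T : measurableType d) (S : set T)
    (S0 : S !=set0) : measurable S ->
  standard_borel R T -> standard_borel R (subset_space S0).
Proof.
move=> mS [f [finj mf fimg]]; exists (f \o subset_val S0); split.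
- apply: inj_comp finj _ => -[x Sx] [y Sy] /= xy; exact: eq_exist.
- exact: (measurableT_comp mf (subset_val_measurable S0)).
- by move=> A mA; rewrite -image_comp; apply: fimg; exact: subset_val_image.
Qed.

Lemma atomless_subsingleton d (T : measurableType d) (mu : probability T R)
    (D : set T) : atomless mu -> measurable D ->
  (forall x y, D x -> D y -> x = y) -> mu D = 0%E.
Proof.
move=> amu mD sD; apply/eqP; rewrite eq_le measure_ge0 andbT leNgt.
apply/negP => /(amu _ mD) [B [mB BD B0]].
have [b Bb] : B !=set0.
  by apply/set0P/eqP => B0'; rewrite B0' measure0 ltxx in B0.
rewrite (_ : B = D) ?ltxx//; apply/seteqP; split => // x Dx.
by rewrite (sD x b)//; exact: BD.
Qed.

(** If A had no measurable subset of intermediate measure, then for every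
rational q almost all of A would lie on one side of the level set g = q. Almost
all of A would then lie on the right side of all rationals at once, that is over
a single point of T, which is null. *)
Lemma atomless_preimage d1 d2 (Z : measurableType d1) (T : measurableType d2)
    (P : probability Z R) (mu : probability T R) (a : Z -> T) :
  standard_borel R T -> atomless mu -> measurable_fun setT a ->
  (forall D, measurable D -> P (a @^-1` D) = mu D) -> atomless P.
Proof.
move=> [g [ginj mg _]] amu ma Pa A mA PA0; apply: contrapT => noB.
pose r_ n : R := ratr (odflt 0 (unpickle n : option rat)).
pose L n := [set x : T | g x <= r_ n].
have mL n : measurable (L n).
  rewrite -[L n]setTI.
  by apply: (@measurable_fun_ler _ _ _ setT g (cst (r_ n)) _ _ measurableT
    [set true]).
have ma' (D : set T) : measurable D -> measurable (a @^-1` D).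
  by move=> mD; rewrite -[X in measurable X]setTI; exact: ma.
(* The side of the n-th level that A avoids almost surely. *)
pose N n := if P (A `&` a @^-1` L n) == 0%E then L n else ~` L n.
have mN n : measurable (N n).
  by rewrite /N; case: ifP => _ //; exact: measurableC.
have PN n : P (A `&` a @^-1` N n) = 0%E.
  rewrite /N; case: ifPn => [/eqP //|PL].
  have mAL : measurable (A `&` a @^-1` L n).
    by apply: measurableI => //; exact: ma'.
  have PAL : P (A `&` a @^-1` L n) = P A.
    apply/eqP; rewrite eq_le le_measure ?inE//= leNgt; apply/negP => ltA.
    apply: noB; exists (A `&` a @^-1` L n); split => //.
    by rewrite lt0e PL measure_ge0.
  have PAfin : (P A < +oo)%E by rewrite ltey_eq fin_num_measure.
  rewrite preimage_setC -setDE (measureD mA (ma' _ (mL n)) PAfin).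
  rewrite [X in (_ - X)%E]PAL.
  by rewrite subee// fin_num_measure.
pose D := ~` \bigcup_n N n.
have mD : measurable D by apply: measurableC; exact: bigcup_measurable.
have D0 : mu D = 0%E.
  apply: atomless_subsingleton => // x y Dx Dy.
  have sep u v : D u -> D v -> g u <= g v.
    move=> Du Dv; rewrite leNgt; apply/negP => /rat_in_itvoo[q].
    rewrite in_itv/= => /andP[vq qu].
    have qE : r_ (pickle q) = ratr q by rewrite /r_ pickleK.
    case: (boolP (P (A `&` a @^-1` L (pickle q)) == 0%E)) => PL.
      by apply: Dv; exists (pickle q) => //; rewrite /N PL /L /= qE ltW.
    apply: Du; exists (pickle q) => //; rewrite /N (negbTE PL) /L /= qE.
    by apply/negP; rewrite -ltNge.
  by apply: ginj; apply/eqP; rewrite eq_le !sep.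
have nullA : P.-negligible A.
  apply: (@negligibleS _ _ _ _ ((a @^-1` D) `|` \bigcup_n (A `&` a @^-1` N n))).
    move=> z Az; have [Dz|] := pselect (D (a z)); first by left.
    by move=> /contrapT[n _ Nn]; right; exists n.
  apply: negligibleU.
    by apply/negligibleP; [exact: ma'|exact: etrans (Pa _ mD) D0].
  apply: negligible_bigcup => n; apply/negligibleP; last exact: PN.
  by apply: measurableI => //; exact: ma'.
have PA := (negligibleP P mA).1 nullA.
by move: PA0; rewrite lt0e => /andP[/eqP].
Qed.

Lemma power_prob_head d (T : measurableType d) (mu : probability T R) n
    (D : set T) : measurable D ->
  power_prob mu n.+1 ((fun t : n.+1.-tuple T => tnth t ord0) @^-1` D) = mu D.
Proof.
move=> mD; pose A (i : 'I_n.+1) := if i == ord0 then D else setT.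
have mA i : measurable (A i) by rewrite /A; case: ifP.
have := power_prob_box mu mA; rewrite big_ord_recl big1 ?mule1.
  rewrite /A eqxx => <-; congr (power_prob mu _ _).
  apply/seteqP; split => t /=.
    by move=> Dt i; case: ifPn => // /eqP ->.
  by move=> /(_ ord0); rewrite eqxx.
by move=> i _; rewrite /A /= probability_setT.
Qed.

Lemma atomless_power d (T : measurableType d) (mu : probability T R) n :
  standard_borel R T -> atomless mu -> atomless (power_prob mu n.+1).
Proof.
move=> sT amu; apply: (atomless_preimage sT amu (measurable_tnth ord0)).
exact: power_prob_head.
Qed.

Lemma atomless_restr d (T : measurableType d) (mu : probability T R)
    (S : set T) (mS : measurable S) (S_gt0 : (0 < mu S)%E) :
  atomless mu -> atomless (restr_prob mu mS S_gt0).
Proof.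
set S0 := pos_measure_neq0 S_gt0.
move=> amu A mA PA.
have a0 : 0 < (fine (mu S))^-1.
  rewrite invr_gt0 fine_gt0// S_gt0 /= ltey_eq fin_num_measure//.
have mvA : measurable (subset_val S0 @` A) by exact: subset_val_image.
have valS (B : set T) : B `<=` S -> mrestr mu mS B = mu B.
  by move=> BS; rewrite /mrestr setIidl.
have vAS : subset_val S0 @` A `<=` S.
  by move=> _ [x _ <-]; exact: set_mem (svalP x).
have PE (B : set (subset_space S0)) :
    restr_prob mu mS S_gt0 B =
    (mu (subset_val S0 @` B) * ((fine (mu S))^-1)%:E)%E.
  by rewrite /restr_prob valS// => _ [x _ <-]; exact: set_mem (svalP x).
have [B [mB BA B0 BltA]] : exists B : set T, [/\ measurable B,
    B `<=` subset_val S0 @` A, (0 < mu B)%E & (mu B < mu (subset_val S0 @` A))%E].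
  apply: amu => //; rewrite lt0e measure_ge0 andbT; apply/eqP => vA0.
  by move: PA; rewrite [X in (_ < X)%E](PE A) vA0 mul0e ltxx.
have valK : subset_val S0 @` (subset_val S0 @^-1` B) = B.
  apply/seteqP; split => [_ [x Bx <-]//|x Bx].
  have [z Az zx] := BA _ Bx; by exists z => //=; rewrite zx.
have val_inj : injective (subset_val S0).
  by move=> [x Sx] [y Sy] /= xy; exact: eq_exist.
exists (subset_val S0 @^-1` B); split.
- by exists B => //; rewrite setTI.
- by move=> x /BA[z Az /val_inj <-].
- by rewrite [X in (_ < X)%E](PE (subset_val S0 @^-1` B)) valK mule_gt0.
- rewrite [X in (X < _)%E](PE (subset_val S0 @^-1` B)) valK.
  by rewrite [X in (_ < X)%E](PE A) lte_pmul2r.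
Qed.

Lemma admissible_all_graphons : admissible (@graphon R).
Proof.
split.
- by [].
- by [].
- move=> W [|k]// _ [sW aW]; split; first exact: standard_borel_tuple.
  exact: atomless_power.
- move=> W S mS S_gt0 [sW aW]; split; first exact: standard_borel_subset.
  exact: atomless_restr.
Qed.

End standard_borel_spaces.

Theorem corollary1p2 (R : realType) :
  (forall C : pregraphon R -> Prop, admissible C ->
    forall H : sgraph, sidorenko C H -> ~ is_matching H ->
      (forcing C H <-> regular_forcing C H))
  /\
  (forall H : sgraph, sidorenko (@graphon R) H -> ~ is_matching H ->
    (forcing (@graphon R) H <-> regular_forcing (@graphon R) H)).
Proof.
suff main (C : pregraphon R -> Prop) : admissible C ->
    forall H : sgraph, sidorenko C H -> ~ is_matching H ->
      (forcing C H <-> regular_forcing C H).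
  by split=> [C|]; apply: main => //; exact: admissible_all_graphons.
move=> admC H sidH Hmatch; split=> [[_ forcingH]|[_ forcingH]].
  by split=> // W CW _; exact: forcingH.
split=> // W CW tE; apply: forcingH => //.
apply: sidorenko_equality_regular tE; first exact: nonisolated_lt_edges.
move=> k S mS S_gt0; apply: sidH; apply: admissible_restriction => //.
exact: admissible_tensor.
Qed.
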